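(* Let $\delta t>0$ and let $\mathbf{a}^{n-1},\mathbf{a}^n\in\mathbb{R}^{2r}$ be given. Each of the following two schemes for the unknown $\mathbf{a}^{n+1}\in\mathbb{R}^{2r}$ is linear (i.e. is a linear system of equations for $\mathbf{a}^{n+1}$) and uniquely solvable (i.e. has exactly one solution $\mathbf{a}^{n+1}$): (CN scheme) $$\mathbf{U}^T\mathcal{L}_h^{*}\mathbf{U}\,\frac{\mathbf{a}^{n+1}-\mathbf{a}^n}{\delta t}=-\mathbf{U}^T\mathcal{L}_h^{*}\,\mathcal{N}_h\big(\mathbf{U}\overline{\mathbf{a}}^{n+\frac12}\big)\,\mathcal{L}_h\big[\mathbf{U}\mathbf{a}^{n+\frac12}\big],$$ with $\overline{\mathbf{a}}^{n+\frac12}=\frac32\mathbf{a}^n-\frac12\mathbf{a}^{n-1}$ and $\mathbf{a}^{n+\frac12}=\frac12\mathbf{a}^{n+1}+\frac12\mathbf{a}^n$; (BDF2 scheme) $$\mathbf{U}^T\mathcal{L}_h^{*}\mathbf{U}\,\frac{3\mathbf{a}^{n+1}-4\mathbf{a}^n+\mathbf{a}^{n-1}}{2\delta t}=-\mathbf{U}^T\mathcal{L}_h^{*}\,\mathcal{N}_h\big(\mathbf{U}\overline{\mathbf{a}}^{n+1}\big)\,\mathcal{L}_h\big[\mathbf{U}\mathbf{a}^{n+1}\big],$$ with $\overline{\mathbf{a}}^{n+1}=2\mathbf{a}^n-\mathbf{a}^{n-1}$.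
   Context: Setting (spatially discretized, energy-quadratized system). Let $N\ge 1$ be the number of spatial grid points and $1\le r\le N$. The full discrete state is $\Psi=\begin{bmatrix}\phi\\ q\end{bmatrix}\in\mathbb{R}^{2N}$ with $\phi,q\in\mathbb{R}^N$. Linear operator: $\mathcal{L}_h=\begin{bmatrix}\mathcal{L}_{0,h}&0\\0&\mathbf{I}_N\end{bmatrix}$, where $\mathcal{L}_{0,h}\in\mathbb{R}^{N\times N}$ is symmetric, positive semi-definite and invertible (hence positive definite); $\mathcal{L}_h^{*}=\mathcal{L}_h^T$ denotes its adjoint. Mobility: $\mathcal{N}_h(\Psi)=\mathcal{N}_0(\Psi)^T(\mathcal{G}_a+\mathcal{G}_s)\mathcal{N}_0(\Psi)\in\mathbb{R}^{2N\times 2N}$, where $\mathcal{G}_a\in\mathbb{R}^{N\times N}$ is skew-symmetric, $\mathcal{G}_s\in\mathbb{R}^{N\times N}$ is symmetric positive semi-definite, and $\mathcal{N}_0(\Psi)=\begin{bmatrix}\mathbf{I}_N & \mathrm{diag}(g(\phi))\end{bmatrix}\in\mathbb{R}^{N\times 2N}$ with $g:\mathbb{R}\to\mathbb{R}$ a given function applied componentwise to $\phi$. Reduced basis: $\mathbf{U}=\begin{bmatrix}\mathbf{U}_\phi&0\\0&\mathbf{U}_q\end{bmatrix}\in\mathbb{R}^{2N\times 2r}$, where $\mathbf{U}_\phi,\mathbf{U}_q\in\mathbb{R}^{N\times r}$ have orthonormal columns (leading left singular vectors of snapshot matrices), so $\mathbf{U}^T\mathbf{U}=\mathbf{I}_{2r}$.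 The reduced unknowns are $\mathbf{a}^k=\begin{bmatrix}\mathbf{a}_\phi^k\\ \mathbf{a}_q^k\end{bmatrix}\in\mathbb{R}^{2r}$, where the superscript $k$ is the time-step index. *)

(* Defs.v *)
From mathcomp Require Import all_boot all_order all_algebra.
From mathcomp Require Import reals.

Set Implicit Arguments.
Unset Strict Implicit.
Unset Printing Implicit Defensive.

Import Order.TTheory GRing.Theory Num.Theory.
Local Open Scope ring_scope.

(* Quadratic-form condition only: symmetry is a separate hypothesis. *)
Definition psd (R : realType) (n : nat) (A : 'M[R]_n) : Prop :=
  forall x : 'cV[R]_n, 0 <= (x^T *m A *m x) 0 0.

Definition Lh (R : realType) (N : nat) (L0 : 'M[R]_N) : 'M[R]_(N + N) :=
  block_mx L0 0 0 1%:M.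

(* [usubmx Psi] is the component phi of Psi = [phi; q]; it is transposed
   because [diag_mx] expects a row vector. *)
Definition N0 (R : realType) (N : nat) (g : R -> R) (Psi : 'cV[R]_(N + N)) :
    'M[R]_(N, N + N) :=
  row_mx 1%:M (diag_mx (map_mx g (usubmx Psi))^T).

Definition Nh (R : realType) (N : nat) (g : R -> R) (Ga Gs : 'M[R]_N)
    (Psi : 'cV[R]_(N + N)) : 'M[R]_(N + N) :=
  (N0 g Psi)^T *m (Ga + Gs) *m N0 g Psi.

Definition Ublock (R : realType) (N r : nat) (Uphi Uq : 'M[R]_(N, r)) :
    'M[R]_(N + N, r + r) :=
  block_mx Uphi 0 0 Uq.

(* The two sides of each scheme, for a linear operator L, a mobility M and a
   basis U; ap, ac, x stand for a^(n-1), a^n, a^(n+1). The adjoint of L for the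
   Euclidean inner product is L^T. *)
Definition CN_lhs (R : realType) (m k : nat) (L : 'M[R]_m) (U : 'M[R]_(m, k))
    (dt : R) (ac x : 'cV[R]_k) : 'cV[R]_k :=
  U^T *m L^T *m U *m (dt^-1 *: (x - ac)).

Definition CN_rhs (R : realType) (m k : nat) (L : 'M[R]_m)
    (M : 'cV[R]_m -> 'M[R]_m) (U : 'M[R]_(m, k)) (ap ac x : 'cV[R]_k) :
    'cV[R]_k :=
  let abar := (3 / 2) *: ac - (1 / 2) *: ap in
  let ahalf := (1 / 2) *: x + (1 / 2) *: ac in
  - (U^T *m L^T *m M (U *m abar) *m (L *m (U *m ahalf))).

Definition BDF2_lhs (R : realType) (m k : nat) (L : 'M[R]_m) (U : 'M[R]_(m, k))
    (dt : R) (ap ac x : 'cV[R]_k) : 'cV[R]_k :=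
  U^T *m L^T *m U *m ((2 * dt)^-1 *: (3 *: x - 4 *: ac + ap)).

Definition BDF2_rhs (R : realType) (m k : nat) (L : 'M[R]_m)
    (M : 'cV[R]_m -> 'M[R]_m) (U : 'M[R]_(m, k)) (ap ac x : 'cV[R]_k) :
    'cV[R]_k :=
  let abar := 2 *: ac - ap in
  - (U^T *m L^T *m M (U *m abar) *m (L *m (U *m x))).

(* The equation F x = G x is a linear system: its residual is affine in x.
   Only asking that the solution set be that of some linear system would be
   vacuous, since any singleton is such a set. *)
Definition linear_system (R : realType) (k : nat) (F G : 'cV[R]_k -> 'cV[R]_k) :
    Prop :=
  exists (A : 'M[R]_k) (b : 'cV[R]_k), forall x, F x - G x = A *m x - b.

Definition uniquely_solvable (R : realType) (k : nat)
    (F G : 'cV[R]_k -> 'cV[R]_k) : Prop :=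
  exists! x : 'cV[R]_k, F x = G x.

(* Main.v *)
Require Import Defs.
From mathcomp Require Import all_boot all_order all_algebra.
From mathcomp Require Import ring lra.
From mathcomp Require Import reals.

Set Implicit Arguments.
Unset Strict Implicit.
Unset Printing Implicit Defensive.

Import Order.TTheory GRing.Theory Num.Theory.
Local Open Scope ring_scope.

(** Collecting the terms in [a^(n+1)], both schemes have the matrix
    [c U^T L U + d (L U)^T M (L U)] with [c > 0] and [d >= 0].  Its quadratic form
    at [x] dominates [c (U x)^T L (U x)], since the skew part of the mobility drops
    out and the symmetric part contributes a nonnegative term.  As [L] is positive
    definite and [U] is injective, the matrix has trivial kernel, hence is
    invertible. *)

Lemma mulmx_trl_eq0 (R : realType) (n : nat) (x : 'cV[R]_n) :
  (x^T *m x) 0 0 = 0 -> x = 0.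
Proof.
rewrite mxE => /eqP; rewrite psumr_eq0 => [/allP x0|i _]; last first.
  by rewrite mxE -expr2 sqr_ge0.
apply/colP => i; have := x0 i (mem_index_enum i).
by rewrite !mxE -expr2 sqrf_eq0 => /eqP.
Qed.

(** The library criterion speaks of row vectors, so the hypothesis on columns is applied to the
    transpose. *)
Lemma unitmx_ker0 (F : fieldType) (n : nat) (A : 'M[F]_n) :
  (forall x : 'cV[F]_n, A *m x = 0 -> x = 0) -> A \in unitmx.
Proof.
move=> kerA; rewrite -unitmx_tr -row_free_unit; apply: inj_row_free => v vA0.
by apply: trmx_inj; rewrite trmx0; apply: kerA; rewrite -[A]trmxK -trmx_mul vA0 trmx0.
Qed.

(** A zero of a nonnegative form is a minimum, so the gradient [2 A x] vanishes there. For
    invertible [A] this turns semi-definiteness into definiteness. *)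
Lemma psd_form_eq0 (R : realType) (n : nat) (A : 'M[R]_n) (x : 'cV[R]_n) :
  A^T = A -> psd A -> (x^T *m A *m x) 0 0 = 0 -> A *m x = 0.
Proof.
move=> Asym Apsd xAx0; apply: mulmx_trl_eq0.
set y := A *m x; set s := (y^T *m y) 0 0; set c := (y^T *m A *m y) 0 0.
have c0 : 0 <= c by exact: Apsd.
(* The form at [x + t y] is [2 t s + t^2 c]; a small negative [t] forces [s = 0]. *)
have q t : 0 <= 2 * t * s + t ^+ 2 * c.
  have := Apsd (x + t *: y).
  suff -> : (x + t *: y)^T *m A *m (x + t *: y) =
      x^T *m A *m x + (2 * t) *: (y^T *m y) + t ^+ 2 *: (y^T *m A *m y).
    by rewrite mxE [X in 0 <= X + _]mxE xAx0 add0r 2![(_ *: _ : 'M[R]_1) 0 0]mxE.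
  have xA : x^T *m A = y^T by rewrite trmx_mul Asym.
  have yAx : y^T *m A *m x = y^T *m y by rewrite -mulmxA.
  rewrite [(_ + _)^T]linearD /= [(_ *: _)^T]linearZ /= !mulmxDl !mulmxDr -!scalemxAl -!scalemxAr.
  rewrite xA yAx scalerA -expr2 -!addrA; congr (_ + _).
  by rewrite !addrA -scalerDl; congr (_ *: _ + _); ring.
have c1 : c + 1 != 0 by rewrite gt_eqF // ltr_wpDl.
(* The minimiser of the quadratic would be [- s / c]; the denominator [c + 1] also covers [c = 0]
   and still gives a nonpositive value, a negative multiple of [s ^+ 2]. *)
have := q (- s / (c + 1)).
have -> : 2 * (- s / (c + 1)) * s + (- s / (c + 1)) ^+ 2 * c =
    - (s ^+ 2 * ((c + 2) / (c + 1) ^+ 2)) by field.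
rewrite oppr_ge0 pmulr_lle0; last first.
  by rewrite divr_gt0 ?exprn_gt0 ?ltr_wpDl.
by move=> s2; apply/eqP; rewrite -sqrf_eq0 eq_le s2 sqr_ge0.
Qed.

(** The form is a 1 by 1 matrix, hence equal to its transpose, while transposing flips its sign. *)
Lemma skew_form_eq0 (R : realType) (n : nat) (A : 'M[R]_n) (x : 'cV[R]_n) :
  A^T = - A -> (x^T *m A *m x) 0 0 = 0.
Proof.
move=> Askew; have : (x^T *m A *m x)^T 0 0 = - (x^T *m A *m x) 0 0.
  by rewrite !trmx_mul trmxK Askew mulNmx mulmxN mulmxA mxE.
by rewrite mxE => ?; lra.
Qed.

Lemma psd_skewDl (R : realType) (n : nat) (A B : 'M[R]_n) :
  A^T = - A -> psd B -> psd (A + B).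
Proof.
by move=> Askew Bpsd x; rewrite mulmxDr mulmxDl mxE skew_form_eq0 // add0r.
Qed.

Lemma psd_congr (R : realType) (m n : nat) (A : 'M[R]_m) (B : 'M[R]_(m, n)) :
  psd A -> psd (B^T *m A *m B).
Proof. by move=> Apsd x; have := Apsd (B *m x); rewrite trmx_mul !mulmxA. Qed.

Lemma psd_Nh (R : realType) (N : nat) (g : R -> R) (Ga Gs : 'M[R]_N)
    (Psi : 'cV[R]_(N + N)) :
  Ga^T = - Ga -> psd Gs -> psd (Nh g Ga Gs Psi).
Proof. by move=> hGa hGs; apply: psd_congr; exact: psd_skewDl. Qed.

Lemma tr_Lh (R : realType) (N : nat) (L0 : 'M[R]_N) :
  L0^T = L0 -> (Lh L0)^T = Lh L0.
Proof. by move=> L0sym; rewrite tr_block_mx L0sym !trmx0 trmx1. Qed.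

Lemma psd_Lh (R : realType) (N : nat) (L0 : 'M[R]_N) : psd L0 -> psd (Lh L0).
Proof.
move=> L0psd x; rewrite -[x]vsubmxK tr_col_mx mul_row_block.
rewrite !mulmx0 addr0 add0r mulmx1 mul_row_col mxE addr_ge0 //.
by rewrite mxE sumr_ge0 // => i _; rewrite mxE -expr2 sqr_ge0.
Qed.

Lemma Lh_unitmx (R : realType) (N : nat) (L0 : 'M[R]_N) :
  L0 \in unitmx -> Lh L0 \in unitmx.
Proof. by rewrite !unitmxE det_ublock det1 mulr1. Qed.

Lemma Ublock_orthonormal (R : realType) (N r : nat) (Uphi Uq : 'M[R]_(N, r)) :
  Uphi^T *m Uphi = 1%:M -> Uq^T *m Uq = 1%:M ->
  (Ublock Uphi Uq)^T *m Ublock Uphi Uq = 1%:M.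
Proof.
move=> hphi hq; rewrite tr_block_mx mulmx_block !trmx0 hphi hq.
by rewrite !(mul0mx, mulmx0) !(addr0, add0r) scalar_mx_block.
Qed.

(** Covers both schemes: Crank-Nicolson takes [c = 1 / dt], [d = 1 / 2], and BDF2 takes
    [c = 3 / (2 dt)], [d = 1]. *)
Lemma reduced_unitmx (R : realType) (m k : nat) (L M : 'M[R]_m)
    (U : 'M[R]_(m, k)) (c d : R) :
  L^T = L -> psd L -> L \in unitmx -> psd M -> U^T *m U = 1%:M ->
  0 < c -> 0 <= d ->
  c *: (U^T *m L^T *m U) + d *: (U^T *m L^T *m M *m L *m U) \in unitmx.
Proof.
move=> Lsym Lpsd Lunit Mpsd UU c0 d0; apply: unitmx_ker0 => x Ax0.
have UxK : U^T *m (U *m x) = x by rewrite mulmxA UU mul1mx.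
have LUpsd := psd_congr (L *m U) Mpsd x.
have Upsd := Lpsd (U *m x).
have LUx0 : ((U *m x)^T *m L *m (U *m x)) 0 0 = 0.
  have : (x^T *m (c *: (U^T *m L^T *m U) +
      d *: (U^T *m L^T *m M *m L *m U)) *m x) 0 0 = 0.
    by rewrite -mulmxA Ax0 mulmx0 mxE.
  rewrite mulmxDr mulmxDl -!scalemxAr -!scalemxAl mxE 2![(_ *: _ : 'M[R]_1) 0 0]mxE.
  have -> : x^T *m (U^T *m L^T *m U) *m x = (U *m x)^T *m L *m (U *m x).
    by rewrite Lsym trmx_mul !mulmxA.
  have -> : x^T *m (U^T *m L^T *m M *m L *m U) *m x =
      x^T *m ((L *m U)^T *m M *m (L *m U)) *m x.
    by rewrite trmx_mul !mulmxA.
  (* Two nonnegative terms with sum zero both vanish; the first one has the factor [c > 0], which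
     can be cancelled. *)
  move/eqP; rewrite paddr_eq0 ?mulr_ge0 ?(ltW c0) // => /andP[+ _].
  by rewrite mulf_eq0 gt_eqF //= => /eqP.
have {}LUx0 := psd_form_eq0 Lsym Lpsd LUx0.
(* Now [L U x = 0], and [x] is recovered from it as [U^T L^-1 (L U x)]. *)
by rewrite -UxK -(mulKmx Lunit (U *m x)) LUx0 !mulmx0.
Qed.

Lemma affine_uniquely_solvable (R : realType) (k : nat)
    (F G : 'cV[R]_k -> 'cV[R]_k) (A : 'M[R]_k) (b : 'cV[R]_k) :
  A \in unitmx -> (forall x, F x - G x = A *m x - b) ->
  linear_system F G /\ uniquely_solvable F G.
Proof.
move=> Aunit FG; split; first by exists A, b.
exists (invmx A *m b); split.
  by apply/eqP; rewrite -subr_eq0 FG mulKVmx // subrr.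
move=> x /eqP; rewrite -subr_eq0 FG subr_eq0 => /eqP <-.
by rewrite mulKmx.
Qed.

Lemma CN_solvable (R : realType) (m k : nat) (L : 'M[R]_m)
    (M : 'cV[R]_m -> 'M[R]_m) (U : 'M[R]_(m, k)) (dt : R) (ap ac : 'cV[R]_k) :
  L^T = L -> psd L -> L \in unitmx -> (forall Psi, psd (M Psi)) ->
  U^T *m U = 1%:M -> 0 < dt ->
  linear_system (CN_lhs L U dt ac) (CN_rhs L M U ap ac) /\
  uniquely_solvable (CN_lhs L U dt ac) (CN_rhs L M U ap ac).
Proof.
move=> Lsym Lpsd Lunit Mpsd UU dt0.
pose abar := (3 / 2) *: ac - (1 / 2) *: ap.
pose K := U^T *m L^T *m U.
pose D := U^T *m L^T *m M (U *m abar) *m L *m U.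
(* The extrapolation [abar] involves known steps only, so [D] does not depend on the unknown. The
   midpoint splits [D] evenly between [x] and [ac], and the [ac] half moves to the right-hand
   side. *)
apply: (@affine_uniquely_solvable _ _ _ _ (dt^-1 *: K + (1 / 2) *: D)
  (dt^-1 *: (K *m ac) - (1 / 2) *: (D *m ac))).
  by apply: reduced_unitmx; rewrite ?invr_gt0 ?divr_ge0.
move=> x; rewrite /CN_lhs /CN_rhs -/abar -/K opprK !mulmxA -/D.
rewrite mulmxDl mulmxDr -!scalemxAl -!scalemxAr mulmxBr scalerBr opprB.
by rewrite addrACA [- _ + _]addrC.
Qed.

Lemma BDF2_solvable (R : realType) (m k : nat) (L : 'M[R]_m)
    (M : 'cV[R]_m -> 'M[R]_m) (U : 'M[R]_(m, k)) (dt : R) (ap ac : 'cV[R]_k) :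
  L^T = L -> psd L -> L \in unitmx -> (forall Psi, psd (M Psi)) ->
  U^T *m U = 1%:M -> 0 < dt ->
  linear_system (BDF2_lhs L U dt ap ac) (BDF2_rhs L M U ap ac) /\
  uniquely_solvable (BDF2_lhs L U dt ap ac) (BDF2_rhs L M U ap ac).
Proof.
move=> Lsym Lpsd Lunit Mpsd UU dt0.
pose abar := 2 *: ac - ap.
pose K := U^T *m L^T *m U.
pose D := U^T *m L^T *m M (U *m abar) *m L *m U.
(* Here the mobility acts on [x] alone, so the right-hand side has no [D] term; the factor [1] only
   matches the shape of [reduced_unitmx]. *)
apply: (@affine_uniquely_solvable _ _ _ _ (((2 * dt)^-1 * 3) *: K + 1 *: D)
  ((2 * dt)^-1 *: (K *m (4 *: ac - ap)))).
  by apply: reduced_unitmx; rewrite // mulr_gt0 ?invr_gt0 ?mulr_gt0.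
move=> x; rewrite /BDF2_lhs /BDF2_rhs -/abar -/K opprK !mulmxA -/D.
rewrite scale1r mulmxDl -scalemxAl -scalerA -scalemxAr [RHS]addrAC.
rewrite [3 *: (K *m x)]scalemxAr -scalerBr -mulmxBr opprB.
by rewrite addrA [_ - _ + ap]addrAC.
Qed.

Theorem theorem4p3 (R : realType) (N r : nat)
    (hr : (1 <= r)%N) (hrN : (r <= N)%N)
    (L0 : 'M[R]_N) (hL0sym : L0^T = L0) (hL0psd : psd L0)
    (hL0inv : L0 \in unitmx)
    (g : R -> R)
    (Ga Gs : 'M[R]_N) (hGa : Ga^T = - Ga) (hGssym : Gs^T = Gs) (hGspsd : psd Gs)
    (Uphi Uq : 'M[R]_(N, r))
    (hUphi : Uphi^T *m Uphi = 1%:M) (hUq : Uq^T *m Uq = 1%:M)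
    (dt : R) (hdt : 0 < dt) (ap ac : 'cV[R]_(r + r)) :
  let L := Lh L0 in
  let M := Nh g Ga Gs in
  let U := Ublock Uphi Uq in
  (linear_system (CN_lhs L U dt ac) (CN_rhs L M U ap ac) /\
   uniquely_solvable (CN_lhs L U dt ac) (CN_rhs L M U ap ac)) /\
  (linear_system (BDF2_lhs L U dt ap ac) (BDF2_rhs L M U ap ac) /\
   uniquely_solvable (BDF2_lhs L U dt ap ac) (BDF2_rhs L M U ap ac)).
Proof.
move=> L M U.
have Lsym : L^T = L by exact: tr_Lh.
have Lpsd : psd L by exact: psd_Lh.
have Lunit : L \in unitmx by exact: Lh_unitmx.
have Mpsd Psi : psd (M Psi) by exact: psd_Nh.
have UU : U^T *m U = 1%:M by exact: Ublock_orthonormal.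
by split; [exact: CN_solvable | exact: BDF2_solvable].
Qed.
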